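(* Let $k\ge 1$, let $\varphi$ be a differential safety property of order $k$, and let $\mathfrak G_\varphi=(\mathcal S,\mathcal A,\mathsf T,\mathcal F_\varphi,s_{\mathrm{init}})$ be the corresponding $k$-th order differential safety game. The direct synthesis algorithm (described in the context), run on $(\mathfrak G_\varphi,\varphi)$, produces a $k$-history dependent maximally permissive winning strategy for $\mathfrak G_\varphi$, if it exists, and has a time complexity of $\mathcal O(|\mathcal S|^{k+1}\cdot|\mathcal A|)$.
   Context: **Sequences.** $\mathbb N=\{0,1,2,\dots\}$. For a set $\mathcal S$, $\mathcal S^*$ and $\mathcal S^\omega$ are the finite and infinite sequences over $\mathcal S$, $\mathcal S^\infty=\mathcal S^*\cup\mathcal S^\omega$, and $\mathcal S^{\le k}$ is the set of sequences (histories) of length at most $k$. For $w=s_1s_2\cdots$, $|w|\in\mathbb N\cup\{\infty\}$ is its length and $w_{1:t}=s_1\cdots s_t$. **Discrete derivatives.** $\mathcal S\subseteq\mathbb R^d$ is finite and $\Delta\tau>0$ is a fixed time step. For $w=s_1s_2\cdots\in\mathcal S^\infty$, $\partial^0_t(w)=s_t$ and $\partial^k_t(w)=(\partial^{k-1}_t(w)-\partial^{k-1}_{t-1}(w))/\Delta\tau$, for $k<t\le|w|$. **Differential safety properties.** These are the formulas $\varphi::=(\partial^k\in\mathcal R)\mid\varphi\land\varphi\mid\lnot\varphi$ with $k\in\mathbb N$, $\mathcal R\subseteq\mathbb R^d$. The order $\mathrm{ord}(\varphi)$ is the largest $k$ occurring in an atom $(\partial^k\in\mathcal R)$ of $\varphi$.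 For $\mathrm{ord}(\varphi)+1\le t\le|w|$, the local value $[\![\varphi]\!]_t(w)\in\{\top,\bot\}$ is defined by: $[\![\partial^j\in\mathcal R]\!]_t(w)=\top$ iff $\partial^j_t(w)\in\mathcal R$, extended to Boolean connectives as usual. Globally, for $\mathrm{ord}(\varphi)=k$, $w\models\varphi$ iff $[\![\varphi]\!]_t(w)=\top$ for all $t$ with $k+1\le t\le|w|$. **Games.** A turn-based game is $\mathfrak G=(\mathcal S,\mathcal A,\mathsf T,\mathcal F,s_{\mathrm{init}})$ with finite state set $\mathcal S$, finite nonempty action set $\mathcal A$, transition relation $\mathsf T\colon\mathcal S\times\mathcal A\to2^{\mathcal S}$ with all values nonempty, winning condition $\mathcal F\subseteq\mathcal S^\omega$, and $s_{\mathrm{init}}\in\mathcal S$. Write $s\xrightarrow{a}s'$ if $s'\in\mathsf T(s,a)$, and $s\to s'$ if this holds for some $a$. A path is $w=s_1s_2\cdots\in\mathcal S^\omega$ with $s_t\to s_{t+1}$ for all $t$; it is winning if $w\in\mathcal F$. A $k$-th order differential safety game $\mathfrak G_\varphi$ has $\mathcal S\subseteq\mathbb R^d$ finite and $\mathcal F=\mathcal F_\varphi=\{w\in\mathcal S^\omega: w\models\varphi\}$ with $\mathrm{ord}(\varphi)=k$. **Strategies.** A strategy is a map $\xi\colon\mathcal S^*\to2^{\mathcal A}$. A sequence $w=s_1s_2\cdots\in\mathcal S^\infty$ is consistent with $\xi$ if for every $t<|w|$ there is $a\in\xi(w_{1:t})$ with $s_t\xrightarrow{a}s_{t+1}$. $\xi$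 is winning if $\xi(w)\ne\emptyset$ for every finite sequence $w$ starting in $s_{\mathrm{init}}$ that is consistent with $\xi$, and every path starting from $s_{\mathrm{init}}$ consistent with $\xi$ is winning. $\xi$ subsumes $\xi'$ if every path consistent with $\xi'$ is also consistent with $\xi$. A winning strategy is maximally permissive if it subsumes every winning strategy. $\xi$ is $k$-history dependent if it depends only on the last $k$ states of the history, and thus can be written as a map $\xi\colon\mathcal S^{\le k}\to2^{\mathcal A}$. **Direct synthesis algorithm**, on input $\mathfrak G_\varphi$, $\varphi$, with $k=\mathrm{ord}(\varphi)$. It maintains $\xi\colon\mathcal S^{\le k}\to2^{\mathcal A}$ (initially $\emptyset$ everywhere) and a set $\mathcal U$ of histories, initially empty. 1. Set $\xi(h)=\mathcal A$ for every history $h$ of length at most $k-1$. 2. For every $(s_1,\dots,s_k)\in\mathcal S^k$ set $\xi(s_1,\dots,s_k)=\{a\in\mathcal A:\forall s'\in\mathsf T(s_k,a),\ [\![\varphi]\!]_{k+1}(s_1,\dots,s_k,s')=\top\}$; if this set is empty, insert $(s_1,\dots,s_k)$ into $\mathcal U$. 3. While $\mathcal U\neq\emptyset$: remove some $(s_1,\dots,s_j)$ from $\mathcal U$. For each $a\in\mathcal A$ define the predecessor set $\bar S$: if $1<j<k$ and $s_{j-1}\xrightarrow{a}s_j$, then $\bar S=\{(s_1,\dots,s_{j-1})\}$; else if $j=k\ge2$ and $s_{k-1}\xrightarrow{a}s_k$, then $\bar S=\{(s_1,\dots,s_{k-1})\}\cup\{(s',s_1,\dots,s_{k-1}): s'\to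 s_1\}$; else $\bar S=\emptyset$. For each $\bar s\in\bar S$: if $\xi(\bar s)=\{a\}$, insert $\bar s$ into $\mathcal U$; then replace $\xi(\bar s)$ by $\xi(\bar s)\setminus\{a\}$. 4. Return $\xi$, read as the $k$-history dependent strategy applying $\xi$ to the last $\min\{|w|,k\}$ states of a history $w$. **Cost convention.** Membership in the sets $\mathcal R$ is decided in constant time, and evaluation of $[\![\varphi]\!]_t$ on a window is treated as constant time.
   Formalization: For k=1, where the printed predecessor set is always empty and the claim fails, the algorithm uses S̄={(s'): s' -a-> s_1}; subsumption compares only paths starting in s_init, since winning strategies are unconstrained on other paths and the claim over all paths is false. *)

(* Defs.v *)
From HB Require Import structures.
From mathcomp Require Import all_boot all_order all_algebra finmap.
From mathcomp Require Import boolp classical_sets reals.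
From Stdlib Require Export Relations.

Set Implicit Arguments.
Unset Strict Implicit.
Unset Printing Implicit Defensive.

Import GRing.Theory Num.Theory.

(* The sequences S^oo = S^* u S^omega. Positions are counted from 0: the letter
   s_t of the usual notation s_1 s_2 ... is the letter at position t.-1. *)
Inductive word (T : Type) := FinWord of seq T | InfWord of nat -> T.

Section Words.
Variable T : Type.
Implicit Type w : word T.

(* [None] beyond the end of a finite word. *)
Definition letter w (i : nat) : option T :=
  match w with FinWord s => onth s i | InfWord f => Some (f i) end.

Definition in_range w (i : nat) : bool :=
  match w with FinWord s => i < size s | InfWord _ => true end.

Definition prefix_of w (t : nat) : seq T :=
  match w with FinWord s => take t s | InfWord f => mkseq f t end.

End Words.

Section Games.

Record game (S A : finType) := Game {
  trans : S -> A -> {set S};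
  wincond : set (nat -> S);
  s_init : S;
  actions_nonempty : 0 < #|A|;
  trans_nonempty : forall s a, trans s a != finset.set0 }.

Variables (S A : finType) (G : game S A).

Definition edge (s s' : S) : bool := [exists a, s' \in trans G s a].

Definition game_path (w : nat -> S) : Prop := forall i, edge (w i) (w i.+1).

Definition strategy := seq S -> {set A}.

Definition consistent (xi : strategy) (w : word S) : Prop :=
  forall i s s', letter w i = Some s -> letter w i.+1 = Some s' ->
  exists2 a, a \in xi (prefix_of w i.+1) & s' \in trans G s a.

Definition winning (xi : strategy) : Prop :=
  (forall h : seq S, letter (FinWord h) 0 = Some (s_init G) ->
     consistent xi (FinWord h) -> xi h != finset.set0) /\
  (forall w : nat -> S, w 0 = s_init G -> game_path w ->
     consistent xi (InfWord w) -> wincond G w).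

(* The paths compared are the plays of the game, i.e. those from the initial
   state: winning constrains nothing on the other ones, so a winning strategy
   may allow everything there. *)
Definition subsumes (xi xi' : strategy) : Prop :=
  forall w : nat -> S, w 0 = s_init G -> game_path w ->
  consistent xi' (InfWord w) -> consistent xi (InfWord w).

Definition maximally_permissive_winning (xi : strategy) : Prop :=
  winning xi /\ forall xi', winning xi' -> subsumes xi xi'.

(* The last min(|h|, k) states of h. *)
Definition last_states (k : nat) (h : seq S) : seq S := drop (size h - k) h.

Definition history_dependent (k : nat) (xi : strategy) : Prop :=
  forall h h', last_states k h = last_states k h' -> xi h = xi h'.

End Games.

Section DifferentialSafety.
Local Open Scope ring_scope.
Variables (R : realType) (d : nat) (dtau : R).
Notation V := 'rV[R]_d.

Inductive property :=
  | Atom of nat & set V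
  | And of property & property
  | Not of property.

Fixpoint ord (phi : property) : nat :=
  match phi with
  | Atom k _ => k
  | And p q => maxn (ord p) (ord q)
  | Not p => ord p
  end.

(* Meaningful at positions [i >= k] only. *)
Fixpoint deriv (k : nat) (f : nat -> V) (i : nat) : V :=
  if k is j.+1 then dtau^-1 *: (deriv j f i - deriv j f i.-1) else f i.

Variable S : {fset V}.

(* The default value 0 is only reached beyond the end of a finite word. *)
Definition vec (w : word S) (i : nat) : V := odflt 0 (omap val (letter w i)).

(* The local value at position [i], i.e. at time [t = i.+1]; meaningful for
   [ord phi <= i]. Membership in a region is the classical boolean one. *)
Fixpoint local_value (phi : property) (i : nat) (w : word S) : bool :=
  match phi with
  | Atom k r => deriv k (vec w) i \in r
  | And p q => local_value p i w && local_value q i w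
  | Not p => ~~ local_value p i w
  end.

Definition satisfies (w : word S) (phi : property) : Prop :=
  forall i, (ord phi <= i)%N -> in_range w i -> local_value phi i w.

Definition diff_safety_game (A : finType) (phi : property) (G : game S A) :
  Prop := forall w : nat -> S, wincond G w <-> satisfies (InfWord w) phi.

End DifferentialSafety.

(* The direct synthesis algorithm as an imperative program on configurations,
   instrumented with a clock. One unit of time is charged for each loop
   iteration, membership test s' \in T(s, a), evaluation of phi on a window,
   emptiness/singleton test of some xi(h), addition or removal of one action
   of some xi(h), and operation on the worklist. *)
Section DirectSynthesis.
Variables (R : realType) (d : nat) (dtau : R).
Variables (S : {fset 'rV[R]_d}) (A : finType).
Variables (phi : property R d) (G : game S A).

Notation k := (ord phi).
Notation history := (k.-bseq S).

Record config := Config {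
  table : {ffun history -> {set A}};
  worklist : {set history};
  clock : nat }.

Definition charge (n : nat) (c : config) : config :=
  Config (table c) (worklist c) (clock c + n).

Definition update (h : history) (B : {set A}) (c : config) : config :=
  Config [ffun g => if g == h then B else table c g] (worklist c) (clock c).

Definition insert (h : history) (c : config) : config :=
  Config (table c) (h |: worklist c)%SET (clock c).

Definition delete (h : history) (c : config) : config :=
  Config (table c) (worklist c :\ h)%SET (clock c).

Definition for_each (T : Type) (r : seq T) (body : T -> config -> config)
  (c : config) : config := foldl (fun c x => body x (charge 1 c)) c r.

(* Allocation of the table, and tabulation of the relation s -> s'. *)
Definition initialize : config :=
  Config [ffun=> finset.set0] finset.set0
    (#|{: history}| * #|A| + #|{: S}| * #|{: S}| * #|A|).

Definition fill_short (h : history) (c : config) : config :=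
  if size h < k then update h [set: A]%SET (charge #|A| c) else c.

(* The defaults of [head] and [last], here and below, are irrelevant: these
   functions are only used on non-empty sequences when [0 < k]. *)
Definition locally_safe (h : history) (a : A) : bool :=
  [forall s' in trans G (last (s_init G) h) a,
     local_value dtau phi k (FinWord (rcons h s'))].

Definition fill_add (h : history) (a : A) (c : config) : config :=
  let c1 := charge (#|{: S}| + #|trans G (last (s_init G) h) a|) c in
  if locally_safe h a then update h (a |: table c1 h)%SET (charge 1 c1) else c1.

Definition fill_full (h : history) (c : config) : config :=
  if size h == k then
    let c1 := for_each (enum A) (fill_add h) (charge 1 c) in
    if table c1 h == finset.set0 then insert h (charge 1 c1) else c1
  else c.

(* The configuration at the entry of the while loop. *)
Definition start : config :=
  for_each (enum {: history}) fill_full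
    (for_each (enum {: history}) fill_short initialize).

(* For [k >= 2] the sequence [init] is s_1 ... s_(j-1), and the transition
   tested is the one from s_(j-1) to s_j. For [k = 1] this sequence is empty
   and the state before s_1 is the added state s' itself, so it is the
   transition from s' to s_1 which has to be labelled by [a]. *)
Definition predecessors (h : history) (a : A) : {set history} :=
  let j := size h in
  let init := take j.-1 h in
  let first := head (s_init G) h in
  let step := last (s_init G) h \in trans G (last (s_init G) init) a in
  if (1 < j < k) && step then [set insub_bseq k init]%SET
  else if [&& j == k, 2 <= k & step] then
    (insub_bseq k init |:
       [set insub_bseq k (s' :: init) | s' in [pred s' | edge G s' first]])%SET
  else if (j == 1) && (k == 1) then
    [set insub_bseq k [:: s'] |
       s' in [pred s' | first \in trans G s' a]]%SET
  else finset.set0.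

Definition prune (a : A) (g : history) (c : config) : config :=
  let c1 := charge 2 c in
  let c2 := if table c1 g == [set a]%SET then insert g (charge 1 c1) else c1 in
  update g (table c2 g :\ a)%SET c2.

(* The predecessor set costs one test, and a scan of all states if [j = k]. *)
Definition propagate (h : history) (a : A) (c : config) : config :=
  for_each (enum (predecessors h a)) (prune a)
    (charge (if size h == k then #|{: S}|.+1 else 1) c).

(* One iteration of the while loop; the history removed from the worklist is
   arbitrary. The two units pay for the loop test and the removal. *)
Definition iteration (c c' : config) : Prop :=
  exists2 h, h \in worklist c &
    c' = for_each (enum A) (propagate h) (delete h (charge 2 c)).

(* No infinite run, whatever the choices of removed histories. *)
Definition terminates : Prop := Acc (fun c' c => iteration c c') start.

Definition strategy_of (t : {ffun history -> {set A}}) : strategy S A :=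
  fun h => t (insub_bseq k (last_states k h)).

(* Some run returns the strategy [xi] after time [n]; the last unit of time is
   the failed loop test. *)
Definition returns (xi : strategy S A) (n : nat) : Prop :=
  exists c, [/\ clos_refl_trans config iteration start c,
    worklist c = finset.set0, xi = strategy_of (table c) & n = (clock c).+1].

End DirectSynthesis.

(* Main.v *)
(* Call a history dead when its entry of the table is empty. Two invariants of
   the loop give correctness. No action allowed by a winning strategy is ever
   removed: it would lead to a dead history, where that strategy also has to
   allow an action. Conversely, a dead history is in the worklist or all actions
   that may lead to it have been removed, so with an empty worklist the returned
   strategy never gets stuck; and its actions at full windows are safe, which is
   all that phi depends on. For the time bound, the number of histories in the
   worklist plus the number of histories which are not dead never grows when an
   action is removed and drops at each iteration, so the number of iterations is
   linear in the number of histories, |S|^k up to a constant (or k when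
   |S| = 1); each iteration costs O(|S| |A|). *)
Require Import Defs.
From mathcomp Require Import all_boot all_order all_algebra finmap.
From mathcomp Require Import boolp classical_sets reals.
From mathcomp Require Import zify.

Set Implicit Arguments.
Unset Strict Implicit.
Unset Printing Implicit Defensive.

Lemma onth_rcons_lt (T : Type) (h : seq T) x i :
  i < size h -> onth (rcons h x) i = onth h i.
Proof. by move=> hi; rewrite -cats1 onth_cat hi. Qed.

Lemma onth_some_lt (T : Type) (h : seq T) x i : onth h i = Some x -> i < size h.
Proof. by move=> hx; rewrite -onthTE hx. Qed.

Lemma onth_last (T : eqType) (x0 : T) (h : seq T) :
  h != [::] -> onth h (size h).-1 = Some (last x0 h).
Proof.
case/lastP: h => // h z _.
by rewrite size_rcons last_rcons -cats1 onth_cat ltnn subnn.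
Qed.

(** * Plays of a strategy *)

Section Plays.
Variables (S A : finType) (G : game S A).
Implicit Types (xi : strategy S A) (h : seq S).

Lemma consistent_rcons xi h s : h != [::] ->
  consistent G xi (FinWord (rcons h s)) <->
  consistent G xi (FinWord h) /\
  exists2 a, a \in xi h & s \in trans G (last (s_init G) h) a.
Proof.
move=> h0; have sh : 0 < size h by rewrite lt0n size_eq0.
rewrite /consistent /letter /prefix_of.
split=> [con|[con stp] i x y].
- split=> [i x y hx hy|].
    have lx := onth_some_lt hx; have ly := onth_some_lt hy.
    case: (con i x y); rewrite ?onth_rcons_lt // => a.
    by rewrite -cats1 takel_cat //; exists a.
  case: (con (size h).-1 (last (s_init G) h) s).
  + by rewrite onth_rcons_lt ?prednK // (onth_last (s_init G)).
  + by rewrite prednK // -cats1 onth_cat ltnn subnn.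
  + by move=> a; rewrite prednK // -cats1 take_size_cat //; exists a.
- move=> hx hy; have := onth_some_lt hy; rewrite size_rcons ltnS leq_eqVlt.
  case/orP=> [/eqP hi|hi].
    have lt : i < size h by rewrite -hi.
    rewrite onth_rcons_lt // in hx; move: hy.
    rewrite hi -cats1 onth_cat ltnn subnn take_size_cat //= => -[<-].
    by move: hx; rewrite -[i]/i.+1.-1 hi (onth_last (s_init G)) // => -[<-].
  move: hx hy; rewrite !onth_rcons_lt // 1?ltnW // => hx hy.
  have [a] := con _ _ _ hx hy.
  by exists a => //; rewrite -cats1 takel_cat // ltnW.
Qed.

Definition play xi h : Prop :=
  letter (FinWord h) 0 = Some (s_init G) /\ consistent G xi (FinWord h).

Lemma play_neq0 xi h : play xi h -> h != [::].
Proof. by case; case: h. Qed.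

Lemma play1 xi : play xi [:: s_init G].
Proof. by split=> // -[|i] x y. Qed.

Lemma play_rcons xi h s a : play xi h -> a \in xi h ->
  s \in trans G (last (s_init G) h) a -> play xi (rcons h s).
Proof.
move=> ph ax hs; have h0 := play_neq0 ph; case: ph => hi con; split.
  by case: h h0 hi {con ax hs}.
by apply/consistent_rcons => //; split=> //; exists a.
Qed.

Lemma play_rcons_inv xi h s : h != [::] -> play xi (rcons h s) ->
  play xi h /\ exists2 a, a \in xi h & s \in trans G (last (s_init G) h) a.
Proof.
move=> h0 [hi /consistent_rcons [] // con stp]; split=> //; split=> //.
by case: h h0 hi {con stp}.
Qed.

Lemma play_ind xi (P : seq S -> Prop) : P [:: s_init G] ->
  (forall h s a, play xi h -> P h -> a \in xi h ->
     s \in trans G (last (s_init G) h) a -> P (rcons h s)) ->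
  forall h, play xi h -> P h.
Proof.
move=> P1 PS; elim/last_ind=> [/play_neq0//|h s IH].
have [->|h0] := eqVneq h [::]; first by case=> /= -[->].
by case/(play_rcons_inv h0) => ph [a]; apply: PS => //; apply: IH.
Qed.

Lemma play_sorted xi h : play xi h -> sorted (edge G) h.
Proof.
elim/play_ind=> // {}h s a /play_neq0 + + _ hs.
case: h hs => //= x h hs _ ph; rewrite rcons_path ph /=.
by apply/existsP; exists a.
Qed.

Lemma play_mkseq xi (w : nat -> S) n : w 0 = s_init G ->
  consistent G xi (InfWord w) -> play xi (mkseq w n.+1).
Proof.
move=> w0 con; elim: n => [|n IH].
  by rewrite /mkseq /= w0; apply: play1.
have [a ax hs] := con n _ _ erefl erefl.
rewrite [mkseq w n.+2]mkseqS; apply: play_rcons IH ax _.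
by rewrite mkseqS last_rcons.
Qed.

Lemma consistent_mkseq xi (w : nat -> S) :
  (forall n, play xi (mkseq w n.+1)) -> consistent G xi (InfWord w).
Proof.
move=> pw i x y /= [<-] [<-]; move: (pw i.+1); rewrite mkseqS.
case/play_rcons_inv=> [|_ [a ax hs]].
  by rewrite mkseqS; case: (mkseq _ _).
by exists a => //; rewrite mkseqS last_rcons in hs.
Qed.

(* A play of a winning strategy never gets stuck, so it is a prefix of an
   infinite one. *)
Lemma winning_extend xi h : winning G xi -> play xi h ->
  exists2 w : nat -> S, mkseq w (size h) = h &
    [/\ w 0 = s_init G, game_path G w, consistent G xi (InfWord w) &
      wincond G w].
Proof.
move=> [live win] ph.
(* The default is never reached on a play: a winning strategy allows an action there, and every
   action has a successor. *)
pose nxt g := odflt (s_init G) [pick s | [exists a,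
  (a \in xi g) && (s \in trans G (last (s_init G) g) a)]].
have nxtP g : play xi g -> play xi (rcons g (nxt g)).
  move=> pg; rewrite /nxt; case: pickP => [s /existsP[a /andP[ax hs]]|no] /=.
    exact: play_rcons pg ax hs.
  have /finset.set0Pn[a ax] := live _ pg.1 pg.2.
  have /finset.set0Pn[s hs] := trans_nonempty G (last (s_init G) g) a.
  by move: (no s) => /existsP[]; exists a; rewrite ax.
pose H n := iter n (fun g => rcons g (nxt g)) h.
have sH n : size (H n) = n + size h.
  by elim: n => //= n IH; rewrite size_rcons IH.
have pH n : play xi (H n) by elim: n => //= n; apply: nxtP.
have tH m n : take (size (H m)) (H (n + m)) = H m.
  elim: n => [|n IH]; first by rewrite take_size.
  by rewrite addSn /= -cats1 takel_cat // !sH; lia.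
have sh : 0 < size h by rewrite lt0n size_eq0 (play_neq0 ph).
(* Diagonal choice: [H i] has more than [i] states, and by [tH] the [H n] are prefixes of one
   another, so [w] extends each of them. *)
pose w i := nth (s_init G) (H i) i.
have wH n : mkseq w (size (H n)) = H n.
  apply: (@eq_from_nth _ (s_init G)); rewrite size_mkseq // => i hi.
  rewrite nth_mkseq // /w.
  have [le|/ltnW le] := leqP i n.
    by rewrite -(tH i (n - i)) subnK // nth_take // sH; lia.
  by rewrite -[in RHS](tH n (i - n)) subnK // nth_take.
(* Nonempty prefixes of plays are plays: last states are stripped from [H n] until length [n.+1] is
   reached. *)
have pw n : play xi (mkseq w n.+1).
  have -> : mkseq w n.+1 = take n.+1 (H n).
    by rewrite -(wH n) -map_take take_iota (minn_idPl _) ?sH //; lia.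
  have lt : n < size (H n) by rewrite sH; lia.
  have := pH n; elim/last_ind: (H n) lt => // g s IH; rewrite size_rcons ltnS.
  rewrite leq_eqVlt => /orP[/eqP ->|lt];
    first by rewrite -(size_rcons g s) take_size.
  case/play_rcons_inv; first by case: g lt {IH}.
  by rewrite -cats1 takel_cat // => /(IH lt).
have w0 : w 0 = s_init G by have [[]] := pw 0.
have cw := consistent_mkseq pw.
have gw : game_path G w.
  by move=> i; have [a _ hs] := cw i _ _ erefl erefl; apply/existsP; exists a.
by exists w; [have := wH 0; rewrite sH add0n|split=> //; apply: win].
Qed.

End Plays.

(** * Locality of differential properties *)

Section Windows.
Variables (R : realType) (d : nat) (dtau : R) (S : {fset 'rV[R]_d}).
Implicit Types (w : word S) (phi : property R d).

(** A [k]-th difference reads only the values at the last [k + 1] positions; the bounds on [i] and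
    [j] keep the subtractions from truncating at 0. *)
Lemma deriv_window k (f g : nat -> 'rV[R]_d) i j : k <= i -> k <= j ->
  (forall l, l <= k -> f (i - l) = g (j - l)) ->
  Defs.deriv dtau k f i = Defs.deriv dtau k g j.
Proof.
elim: k i j => [|k IH] i j ki kj fg /=.
  by have := fg 0 isT; rewrite !subn0.
rewrite (IH i j) ?(IH i.-1 j.-1) //; try lia.
- move=> l lk; have -> : i.-1 - l = i - l.+1 by lia.
  have -> : j.-1 - l = j - l.+1 by lia.
  exact: fg.
- by move=> l lk; apply: fg; lia.
Qed.

Lemma local_value_window phi w w' i j : ord phi <= i -> ord phi <= j ->
  (forall l, l <= ord phi -> letter w (i - l) = letter w' (j - l)) ->
  local_value dtau phi i w = local_value dtau phi j w'.
Proof.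
elim: phi => [k r|p IHp q IHq|p IH] /=; last 1 first.
- by move=> *; rewrite IH.
- move=> ki kj ww; rewrite (@deriv_window k (vec w) (vec w') i j) // => l lk.
  by rewrite /vec ww.
- rewrite !geq_max => /andP[pi qi] /andP[pj qj] ww.
  by rewrite IHp ?IHq // => l le; apply: ww; rewrite leq_max le ?orbT.
Qed.

Lemma rcons_take_last (T : Type) (x0 : T) (h : seq T) :
  0 < size h -> rcons (take (size h).-1 h) (last x0 h) = h.
Proof.
case/lastP: h => // h x _.
by rewrite size_rcons last_rcons -[in take _ _]cats1 take_size_cat.
Qed.

Lemma size_last_states (T : finType) k (h : seq T) :
  size (last_states k h) = minn (size h) k.
Proof. by rewrite size_drop; lia. Qed.

Lemma last_states_id (T : finType) k (h : seq T) : size h <= k ->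
  last_states k h = h.
Proof. by rewrite -subn_eq0 /last_states => /eqP ->; rewrite drop0. Qed.

Lemma last_last_states (T : finType) (x0 : T) k (h : seq T) :
  0 < k -> last x0 (last_states k h) = last x0 h.
Proof.
move=> k0; case/lastP: h => // h x; rewrite /last_states drop_rcons.
  by rewrite !last_rcons.
by rewrite size_rcons; lia.
Qed.

Lemma last_states_rcons (T : finType) k (h : seq T) x : k <= size h ->
  last_states k (rcons h x) = behead (rcons (last_states k h) x).
Proof.
move=> kh; rewrite /last_states size_rcons subSn // -addn1 addnC -drop_drop.
rewrite drop1 drop_rcons //; lia.
Qed.

Lemma last_states_rcons_short (T : finType) k (h : seq T) x : size h < k ->
  last_states k (rcons h x) = rcons (last_states k h) x.
Proof. by move=> hk; rewrite !last_states_id // ?size_rcons // ltnW. Qed.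

(** Turns the truth of [phi] at a position of an infinite path into the test made by [locally_safe],
    on the preceding window followed by the current state. *)
Lemma local_value_last_states phi (w : nat -> S) i : ord phi <= i ->
  local_value dtau phi i (InfWord w) =
  local_value dtau phi (ord phi)
    (FinWord (rcons (last_states (ord phi) (mkseq w i)) (w i))).
Proof.
move=> ki; apply: local_value_window => // l lk.
rewrite /= /last_states size_mkseq /mkseq -map_drop drop_iota -map_rcons.
(* Window and current state are joined into one interval of [ord phi + 1] indices starting at
   [i - ord phi]. *)
rewrite add0n subKn // -cats1 (_ : [:: i] = iota (i - ord phi + ord phi) 1).
  rewrite -iotaD onth_map.
  rewrite onthE (nth_map 0) ?size_iota; last lia.
  rewrite nth_iota /=; last lia.
  by congr (Some (w _)); lia.
by rewrite subnK.
Qed.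

End Windows.

(** * The synthesis algorithm *)

Section Algorithm.
Variables (R : realType) (d : nat) (dtau : R).
Variables (S : {fset 'rV[R]_d}) (A : finType).
Variables (phi : property R d) (G : game S A).
Hypothesis k_gt0 : 0 < ord phi.

Notation k := (ord phi).
Notation history := (k.-bseq S).
Notation config := (config S A phi).
Implicit Types (c : config) (g h : history) (a : A).

(** * Windows and their predecessors *)

Definition window (h : seq S) : history := insub_bseq k (last_states k h).

Lemma val_insub_bseq (s : seq S) : size s <= k -> insub_bseq k s = s :> seq S.
Proof. by move=> sk; rewrite /insub_bseq insubdK. Qed.

Lemma val_window (h : seq S) : window h = last_states k h :> seq S.
Proof. by rewrite val_insub_bseq // size_last_states geq_minr. Qed.

Lemma size_window (h : seq S) : size (window h) = minn (size h) k.
Proof. by rewrite val_window size_last_states. Qed.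

(* [h] is required to be a path because a full window is only a predecessor
   when its first transition exists. *)
Lemma window_predecessor (h : seq S) s a : h != [::] -> sorted (edge G) h ->
  s \in trans G (last (s_init G) h) a ->
  window h \in predecessors G (window (rcons h s)) a.
Proof.
move=> h0 ph hs; rewrite /predecessors; cbv zeta; rewrite val_window.
have sh : 0 < size h by rewrite lt0n size_eq0.
have [hk|kh] := ltnP (size h) k.
  have -> : last_states k (rcons h s) = rcons h s.
    by apply: last_states_id; rewrite size_rcons.
  rewrite last_rcons size_rcons /= -cats1 take_size_cat // hs.
  have wh : window h = insub_bseq k h by rewrite /window last_states_id // ltnW.
  have [lt|le] := ltnP (size h).+1 k; first by rewrite ltnS sh /= inE wh.
  (* The extended window has just become full, so [h] is the truncated sequence of the branch
     [j = k]. *)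
  have kE : (size h).+1 == k by lia.
  have k1 : 1 < k by lia.
  by rewrite andbF kE k1 /= !inE wh eqxx.
rewrite last_states_rcons //;
  move: (val_window h) (last_last_states (s_init G) h k_gt0).
have : size (last_states k h) = k by rewrite size_last_states; apply/minn_idPr.
have : sorted (edge G) (last_states k h) by apply: drop_sorted.
case: (last_states k h) => [|x t] /= pt st; first by lia.
move=> wh lt; rewrite size_rcons st ltnn andbF eqxx /= -cats1 take_size_cat;
  last by rewrite -st.
(* The state [x] has been shifted out of the window. If [k = 1] it is the whole predecessor and
   carries the action itself; otherwise it is put back in front, its edge to [y] coming from the
   path. *)
rewrite last_cat /=; case: t pt st wh lt => [|y t] /= pt st wh lt.
  have [k1 k2] : (1 < k = false) * (k == 1) by rewrite -st.
  rewrite k1 k2 /=; apply/imsetP; exists x; first by rewrite inE lt.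
  by apply: val_inj; rewrite /= wh val_insub_bseq // -st.
have k1 : 1 < k by rewrite -st.
rewrite k1 lt hs /= !inE; apply/orP; right; apply/imsetP; exists x.
  by rewrite inE; case/andP: pt.
by apply: val_inj; rewrite /= wh val_insub_bseq //= -st.
Qed.

(** This justifies pruning: at every history whose window is listed, [a] can really lead to [g]. The
    successor is the last state of [g]. *)
Lemma predecessor_window (h : seq S) (g : history) a : h != [::] ->
  window h \in predecessors G g a ->
  exists2 s, s \in trans G (last (s_init G) h) a & window (rcons h s) = g.
Proof.
move=> h0; rewrite /predecessors; set st := (_ \in _).
have ll := last_last_states (s_init G) h k_gt0.
(* The truncated predecessor, common to the first two branches, is shorter than [k]; hence so is
   [h], and nothing is shifted out. *)
have ini : 1 < size g -> st -> window h = insub_bseq k (take (size g).-1 g) ->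
    exists2 s, s \in trans G (last (s_init G) h) a & window (rcons h s) = g.
  move=> sg hst /(congr1 val) /=; rewrite val_window val_insub_bseq; last first.
    by rewrite size_take; have := size_bseq g; case: ifP; lia.
  move=> wh; exists (last (s_init G) g); first by rewrite -ll wh.
  have sw : size (last_states k h) < k.
    by rewrite wh size_take; have := size_bseq g; case: ifP; lia.
  apply: val_inj; rewrite /= val_window last_states_rcons_short; last first.
    by move: sw; rewrite size_last_states; lia.
  by rewrite wh rcons_take_last // (leq_trans _ sg).
case: ifP => [/andP[/andP[sg _] hst]|_];
  first by rewrite inE => /eqP; apply: ini.
case: ifP => [/and3P[/eqP sg k2 hst]|_].
  rewrite !inE => /orP[/eqP|/imsetP[x _]];
    first by apply: ini => //; rewrite sg.
  move=> /(congr1 val) /=; rewrite val_window val_insub_bseq; last first.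
    by rewrite /= size_take sg; case: ifP; lia.
  move=> wh; have sw : size (last_states k h) = k.
    by rewrite wh /= size_take sg; case: ifP; lia.
  exists (last (s_init G) g).
    (* As [k >= 2], the truncated sequence is nonempty, so its last state is the same with the
       default [x] as with [s_init G]. *)
    rewrite -ll wh /=; move: hst; rewrite /st.
    by case: (bseqval g) sg k2 => [|y [|z t]] //= <-.
  apply: val_inj; rewrite /= val_window last_states_rcons; last first.
    by move: sw; rewrite size_last_states; lia.
  by rewrite wh /= rcons_take_last // sg.
case: ifP => [/andP[/eqP sg /eqP k1]|_]; last by rewrite inE.
case/imsetP=> x; rewrite inE => hx.
move=> /(congr1 val) /=; rewrite val_window val_insub_bseq ?k1 // => wh.
exists (head (s_init G) g); first by rewrite -ll wh.
apply: val_inj; rewrite /= val_window last_states_rcons; last first.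
  by rewrite [leqLHS]k1 lt0n size_eq0.
by rewrite wh /=; case: (bseqval g) sg => [|y []].
Qed.

Lemma card_predecessors g a : #|predecessors G g a| <= #|{: S}|.+1.
Proof.
rewrite /predecessors; case: ifP => _; first by rewrite cards1.
case: ifP => _.
  rewrite (leq_trans (leq_card_setU _ _)) // cards1 add1n ltnS.
  by rewrite (leq_trans (leq_imset_card _ _)) // max_card.
case: ifP => _; last by rewrite cards0.
by rewrite leqW // (leq_trans (leq_imset_card _ _)) // max_card.
Qed.

(** * Rules for the loops of the program *)

Lemma for_each_ind (T : eqType) (P : config -> Prop) (r : seq T) body :
  (forall n c, P c -> P (charge n c)) ->
  (forall x c, x \in r -> P c -> P (body x c)) ->
  forall c, P c -> P (for_each r body c).
Proof.
move=> Pch; elim: r => //= x r IH Pb c Pc; apply: IH.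
  by move=> y c' yr; apply: Pb; rewrite inE yr orbT.
by apply: Pb; rewrite ?inE ?eqxx //; apply: Pch.
Qed.

(** The iteration at [x] establishes [P] whatever came before, and the later ones preserve it. *)
Lemma for_each_reach (T : eqType) (P : config -> Prop) (r : seq T) body x :
  (forall n c, P c -> P (charge n c)) ->
  (forall y c, P c -> P (body y c)) -> (forall c, P (body x c)) ->
  x \in r -> forall c, P (for_each r body c).
Proof.
move=> Pch Pb Px; elim: r => //= y r IH.
rewrite inE => /orP[/eqP <-|xr] c; last exact: IH.
by apply: (@for_each_ind _ P) => // z c' _; apply: Pb.
Qed.

(** The successor in [m.+1] is the unit that [for_each] charges per iteration. *)
Lemma for_each_clock (T : eqType) (r : seq T) body m :
  (forall x c, clock (body x c) <= clock c + m) ->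
  forall c, clock (for_each r body c) <= clock c + size r * m.+1.
Proof.
move=> cb; elim: r => [|x r IH] c /=; first by rewrite addn0.
apply: leq_trans (IH _) _; have := cb x (charge 1 c); rewrite /= mulSn; lia.
Qed.

Lemma table_update h g (B : {set A}) c :
  table (update h B c) g = if g == h then B else table c g.
Proof. by rewrite ffunE. Qed.

Lemma table_prune a g h c :
  table (prune a g c) h = if h == g then table c g :\ a else table c h.
Proof. by rewrite table_update /=; case: ifP; case: ifP. Qed.

Lemma worklist_prune a g c : worklist (prune a g c) =
  if table c g == [set a] then g |: worklist c else worklist c.
Proof. by rewrite /prune /=; case: ifP. Qed.

Lemma table_prune_sub a g h c : table (prune a g c) h \subset table c h.
Proof.
by rewrite table_prune; case: eqP => [->|//]; exact: finset.subsetDl.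
Qed.

Lemma propagate_ind (P : config -> Prop) h :
  (forall n c, P c -> P (charge n c)) ->
  (forall a g c, g \in predecessors G h a -> P c -> P (prune a g c)) ->
  forall a c, P c -> P (propagate G h a c).
Proof.
move=> Pch Pb a c Pc; apply: for_each_ind => //; last exact: Pch.
by move=> g c'; rewrite mem_enum; apply: Pb.
Qed.

Lemma propagate_all_ind (P : config -> Prop) h :
  (forall n c, P c -> P (charge n c)) ->
  (forall a g c, g \in predecessors G h a -> P c -> P (prune a g c)) ->
  forall c, P c -> P (for_each (enum A) (propagate G h) c).
Proof.
move=> Pch Pb; apply: for_each_ind => // a c _; exact: propagate_ind.
Qed.

(** The iteration for [a] and [g] removes the action, and pruning never adds one back. *)
Lemma propagate_all_pruned h a g c : g \in predecessors G h a ->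
  a \notin table (for_each (enum A) (propagate G h) c) g.
Proof.
have shr b g' c' : a \notin table c' g -> a \notin table (prune b g' c') g.
  by apply: contra => /(fintype.subsetP (table_prune_sub b g' g c')); apply.
move=> ga; apply: (@for_each_reach _ (fun c => a \notin table c g) _ _ a) => //.
- move=> b c'; apply: (@propagate_ind (fun c => a \notin table c g)) => //.
  by move=> ? ? ? _; apply: shr.
- move=> c';
  apply: (@for_each_reach _ (fun c => a \notin table c g) _ _ g) => //.
  + by move=> ? ?; apply: shr.
  + by move=> c''; rewrite table_prune eqxx !inE eqxx.
  + by rewrite mem_enum.
- by rewrite mem_enum.
Qed.

(** * Invariant of the while loop *)

(* [D] is the set of the dead histories popped from the worklist and being
   processed. *)
Definition invariant (xi : strategy S A) (D : {set history}) c : Prop :=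
  [/\ forall h : seq S, play G xi h -> xi h \subset table c (window h),
      forall h, h \in worklist c :|: D -> table c h = finset.set0,
      forall h, table c h = finset.set0 -> h \in worklist c :|: D \/
        forall a g, g \in predecessors G h a -> a \notin table c g
    & forall h a, size h = k -> a \in table c h -> locally_safe dtau G h a].

Lemma invariant_prune xi h c a g : winning G xi ->
  g \in predecessors G h a ->
  invariant xi [set h] c -> invariant xi [set h] (prune a g c).
Proof.
move=> [live _] ga [sound dead compl safe].
have sub x := table_prune_sub a g x c.
have wsub x : x \in worklist c :|: [set h] ->
    x \in worklist (prune a g c) :|: [set h].
  rewrite worklist_prune !inE => /orP[xw|->]; last by rewrite orbT.
  by case: ifP; rewrite ?inE xw ?orbT.
split.
- move=> p pp; rewrite table_prune; case: eqP => [wp|_]; last exact: sound.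
  (* If [xi] allowed [a] at [p], some play of [xi] would have the window [h]; there [xi] allows an
     action [b], which soundness puts in the empty entry of [h]. *)
  rewrite finset.subsetD1 -wp sound //=; apply/negP => ax.
  case: (@predecessor_window p h a); [exact: play_neq0 pp|by rewrite wp|].
  move=> s hs ws; have ps := play_rcons pp ax hs.
  case/finset.set0Pn: (live _ ps.1 ps.2) => b bx.
  have := fintype.subsetP (sound _ ps) b bx.
  by rewrite ws dead ?inE // eqxx orbT.
- move=> x; rewrite worklist_prune.
  have shr : x \in worklist c :|: [set h] ->
      table (prune a g c) x = finset.set0.
    by move=> xw; apply/eqP; rewrite -finset.subset0 -(dead x xw) sub.
  case: ifP => // /eqP tg;
    rewrite -finset.setUA finset.in_setU1 => /orP[/eqP ->|//].
  by rewrite table_prune eqxx tg finset.setDv.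
- move=> x; rewrite table_prune; case: eqP => [->|_] tx.
    (* An entry emptied by this removal was [[set a]], so [g] has just been inserted. Otherwise it
       was empty before, and the old clause survives because entries only shrink. *)
    have [tg|tg] := eqVneq (table c g) [set a].
      by left; rewrite worklist_prune tg eqxx !inE eqxx.
    have /compl[xw|no] : table c g = finset.set0.
      apply/eqP; move/eqP: tx;
        rewrite finset.setD_eq0 finset.subset1 => /orP[|//].
      by rewrite (negPf tg).
    + by left; apply: wsub.
    + by right=> b y /no; apply: contra => /(fintype.subsetP (sub y)); apply.
  case: (compl x tx) => [xw|no]; first by left; apply: wsub.
  by right=> b y /no; apply: contra => /(fintype.subsetP (sub y)); apply.
- by move=> x b xk bx; apply: safe xk _; exact: (fintype.subsetP (sub x)) bx.
Qed.

(** Popping [h] moves it from the worklist to [D], which leaves their union unchanged. Once all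
    actions are propagated, every predecessor of [h] is pruned, so [h] may leave [D]. *)
Lemma invariant_iteration xi c c' : winning G xi ->
  iteration G c c' -> invariant xi finset.set0 c -> invariant xi finset.set0 c'.
Proof.
move=> wx [h hw ->] inv.
pose c0 := delete h (charge 2 c).
have : invariant xi [set h] c0.
  have E : worklist c :|: finset.set0 = worklist c0 :|: [set h].
    by rewrite finset.setU0 finset.setUC /c0 /= finset.setD1K.
  by case: inv; rewrite E.
move=> /(@propagate_all_ind (invariant xi [set h]) h (fun _ _ => id)
  (fun _ _ _ => @invariant_prune _ _ _ _ _ wx)).
set c1 := for_each _ _ _; case=> sound dead compl safe; split=> //.
- by move=> x; rewrite finset.setU0 => xw; apply: dead; rewrite inE xw.
- move=> x /compl; rewrite finset.setU0 !inE => -[/orP[xw|/eqP ->]|no].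
  + by left.
  + by right=> a g; apply: propagate_all_pruned.
  + by right.
Qed.

(** * The configuration at loop entry *)

Lemma fill_short_table c :
  (forall g, size g = k -> table c g = finset.set0) ->
  worklist c = finset.set0 ->
  let c' := for_each (enum {: history}) (@fill_short _ _ _ _ _) c in
  [/\ forall g, size g = k -> table c' g = finset.set0,
      worklist c' = finset.set0 &
      forall g, size g < k -> table c' g = [set: A]].
Proof.
move=> t0 w0 /=; split.
- pose P c := forall g, size g = k -> table c g = finset.set0.
  apply: (@for_each_ind _ P) => //.
  move=> x c' _ IH g gk; rewrite /fill_short.
  case: ifP => [xk|_]; last exact: IH.
  by rewrite table_update; case: eqP => [gx|_];
    [rewrite -gx gk ltnn in xk|apply: IH].
- by apply: (@for_each_ind _ (fun c => worklist c = finset.set0)) => // x c' _;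
    rewrite /fill_short; case: ifP.
- move=> g gk.
  apply: (@for_each_reach _ (fun c => table c g = [set: A]) _ _ g) => //.
  + by move=> x c'; rewrite /fill_short; case: ifP => // _;
      rewrite table_update; case: ifP.
  + by move=> c'; rewrite /fill_short gk table_update eqxx.
  + by rewrite mem_enum.
Qed.

Lemma fill_add_all h a c : locally_safe dtau G h a ->
  a \in table (for_each (enum A) (fill_add dtau G h) c) h.
Proof.
move=> sa; apply: (@for_each_reach _ (fun c => a \in table c h) _ _ a) => //.
- move=> b c'; rewrite /fill_add; case: ifP => // _.
  by rewrite table_update eqxx finset.in_setU1 => ->; rewrite orbT.
- by move=> c'; rewrite /fill_add sa table_update eqxx !inE eqxx.
- by rewrite mem_enum.
Qed.

Lemma fill_full_done h c : size h = k ->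
  (forall a, locally_safe dtau G h a -> a \in table (fill_full dtau G h c) h) /\
  (table (fill_full dtau G h c) h = finset.set0 ->
    h \in worklist (fill_full dtau G h c)).
Proof.
rewrite /fill_full => ->; rewrite eqxx; case: ifP => [_|/eqP //].
  by split=> [a sa|_]; [apply: fill_add_all|rewrite !inE eqxx].
by split=> // a sa; apply: fill_add_all.
Qed.

(** Reduces [fill_full] to its elementary effects: charging time, adding a safe action at a full
    history, and inserting a full history without safe actions. *)
Lemma fill_full_ind (P : config -> Prop) :
  (forall n c, P c -> P (charge n c)) ->
  (forall h a c, size h = k -> locally_safe dtau G h a -> P c ->
     P (update h (a |: table c h) c)) ->
  (forall h c, size h = k -> (forall a, ~~ locally_safe dtau G h a) ->
     P c -> P (insert h c)) ->
  forall h c, P c -> P (fill_full dtau G h c).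
Proof.
move=> Pch Pup Pin h c Pc; rewrite /fill_full; case: eqP => // hk.
set c1 := for_each _ _ _.
have P1 : P c1.
  apply: (@for_each_ind _ P) => //; last exact: Pch.
  move=> a c' _ Pc'; rewrite /fill_add; case: ifP => sa; last exact: Pch.
  by apply: Pup => //; apply: (Pch _ _ (Pch _ _ Pc')).
case: eqP => // t0; apply: Pin => //; last exact: Pch.
move=> a; apply/negP => /(@fill_add_all _ _ (charge 1 c)).
by rewrite -/c1 t0 inE.
Qed.

Lemma start_table :
  [/\ forall h, size h < k -> table (start dtau phi G) h = [set: A],
      forall h a, size h = k ->
        (a \in table (start dtau phi G) h) = locally_safe dtau G h a
    & forall h, table (start dtau phi G) h = finset.set0 <->
        h \in worklist (start dtau phi G)].
Proof.
rewrite /start; set c0 := for_each (enum _) _ (initialize _ _ _).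
have [||t0 w0 tT] := @fill_short_table (initialize S A phi).
- by move=> g _; rewrite ffunE.
- by [].
rewrite -/c0 in t0 w0 tT; set c1 := for_each _ _ _.
(* [P] bounds the table and the worklist from above throughout the loop; the converse inclusions, in
   [done], come from the iteration at [h] itself and persist afterwards. *)
pose P c := [/\ forall h, size h < k -> table c h = [set: A],
    forall h a, size h = k -> a \in table c h -> locally_safe dtau G h a
  & forall h, h \in worklist c ->
      size h = k /\ forall a, ~~ locally_safe dtau G h a].
have [short safe wl] : P c1.
  apply: (@for_each_ind _ P) => //; last first.
    split=> //; first by move=> h a /t0 ->; rewrite inE.
    by move=> h; rewrite w0 inE.
  move=> h c _; apply: (@fill_full_ind P) => {h c} //.
  - move=> h a c hk sa [short safe wl]; split=> //.
    + move=> g gk; rewrite table_update; case: eqP => [gh|_]; last exact: short.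
      by rewrite gh hk ltnn in gk.
    + move=> g b gk; rewrite table_update; case: eqP => [->|_];
      last exact: safe.
      by rewrite finset.in_setU1 => /orP[/eqP ->|] //; apply: safe.
  - move=> h c hk ns [short safe wl]; split=> // g.
    by rewrite finset.in_setU1 => /orP[/eqP ->|/wl].
have done h : size h = k ->
    (forall a, locally_safe dtau G h a -> a \in table c1 h) /\
    (table c1 h = finset.set0 -> h \in worklist c1).
  move=> hk; pose Q c :=
    (forall a, locally_safe dtau G h a -> a \in table c h) /\
    (table c h = finset.set0 -> h \in worklist c).
  apply: (@for_each_reach _ Q _ _ h) => //.
  - move=> g c; apply: (@fill_full_ind Q) => {g c} //.
    + move=> g b c gk _ [full wl']; split=> [a /full|].
        by rewrite table_update; case: eqP => // ->; rewrite !inE orbC => ->.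
      rewrite table_update; case: eqP => // -> E;
        suff: b \in finset.set0 by rewrite inE.
      by rewrite -E !inE eqxx.
    + move=> g c gk _ [full wl']; split=> // /wl'.
      by rewrite finset.in_setU1 orbC => ->.
  - by move=> c; apply: fill_full_done.
  - by rewrite mem_enum.
split=> // [h a hk|h].
  by apply/idP/idP; [apply: safe|case: (done h hk) => + _; apply].
split=> [E|/wl[hk ns]].
  (* A short history cannot be dead: its entry contains every action, and [A] is nonempty. *)
  have [hk|kh] := ltnP (size h) k; last first.
    by apply: (done h _).2 E; apply/eqP; rewrite eqn_leq size_bseq.
  case/card_gt0P: (actions_nonempty G) => a _.
  suff: a \in finset.set0 by rewrite inE.
  by rewrite -E short // inE.
apply/setP=> a; rewrite inE; apply/negP => /(safe _ _ hk); exact/negP.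
Qed.

(** An action that [xi] allows at a play of length at least [k] is locally safe: each of its
    successors continues to an infinite winning path, on which [phi] holds at the position of that
    successor. *)
Lemma invariant_start xi : diff_safety_game dtau phi G -> winning G xi ->
  invariant xi finset.set0 (start dtau phi G).
Proof.
move=> HG wx; have [short full wl] := start_table; split.
- move=> p pp; apply/fintype.subsetP => a ax.
  have [pk|kp] := ltnP (size p) k.
    by rewrite short ?inE // size_window gtn_min pk.
  rewrite full ?size_window; last exact/minn_idPr.
  apply/forall_inP => s; rewrite val_window last_last_states // => hs.
  have [w mw [_ _ _ win]] := winning_extend wx (play_rcons pp ax hs).
  move/HG: win => /(_ (size p) kp isT); rewrite local_value_last_states //.
  move: mw; rewrite size_rcons mkseqS => /rcons_inj[-> ->]; exact: id.
- by move=> h; rewrite finset.setU0 => /wl.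
- by move=> h /wl hw; left; rewrite finset.setU0.
- by move=> h a hk; rewrite full.
Qed.

(** * Correctness of the returned strategy *)

(** The invariant depends on a winning strategy: the instance at [xi] gives that [xi] is subsumed,
    and a single instance, at [xi0], gives that the result wins. *)
Lemma final_maximally_permissive c : diff_safety_game dtau phi G ->
  (exists xi, winning G xi) ->
  (forall xi, winning G xi -> invariant xi finset.set0 c) ->
  worklist c = finset.set0 ->
  maximally_permissive_winning G (strategy_of (table c)).
Proof.
move=> HG [xi0 wx0] inv w0; split; last first.
  move=> xi wx w wi gw con i x y hx hy.
  have [a ax hs] := con i x y hx hy; exists a => //.
  have [sound _ _ _] := inv xi wx.
  exact: fintype.subsetP (sound _ (play_mkseq i wi con)) a ax.
have [sound _ compl safe] := inv xi0 wx0; split.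
  move=> h hi con; have : play G (strategy_of (table c)) h by [].
  elim/play_ind => {h hi con}.
    (* The initial window is not dead, since its entry contains the actions of [xi0] there. *)
    have p1 := play1 G xi0.
    have /finset.set0Pn[a ax] := wx0.1 _ p1.1 p1.2.
    by apply/finset.set0Pn; exists a; apply: fintype.subsetP (sound _ p1) a ax.
  (* Were the new window dead, the empty worklist would force [a] to have been pruned at [window h],
     against [ax]. *)
  move=> h s a ph _ ax hs; apply/eqP => /compl.
  rewrite finset.setU0 w0 inE => -[//|no].
  have wp := window_predecessor (play_neq0 ph) (play_sorted ph) hs.
  by have := no _ _ wp; rewrite ax.
move=> w wi gw con; apply/HG => i ki _; rewrite local_value_last_states //.
case: i ki => [|i] ki; first by move: k_gt0; rewrite ltnNge ki.
have [a ax hs] := con i _ _ erefl erefl.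
have sk : size (window (mkseq w i.+1)) = k.
  by rewrite size_window size_mkseq; apply/minn_idPr.
have /forall_inP/(_ (w i.+1)) := safe _ _ sk ax.
rewrite val_window last_last_states // => -> //.
by rewrite mkseqS last_rcons.
Qed.

(** * Termination and time bound *)

Notation N := #|{: S}|.
Notation H := #|{: history}|.

Definition potential c : nat :=
  #|worklist c| + #|[set h | table c h != finset.set0]|.

(** [g] is inserted only when it loses its last action, so a gain in the worklist is paid for by the
    loss of a live history. *)
Lemma potential_prune a g c : potential (prune a g c) <= potential c.
Proof.
rewrite /potential worklist_prune.
set X := [set h | _]; set Y := [set h | _].
have XY : X \subset Y.
  apply/fintype.subsetP => h; rewrite !inE; apply: contra => /eqP th.
  by rewrite -finset.subset0 -th table_prune_sub.
case: eqP => [tg|_]; last by rewrite leq_add2l subset_leq_card.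
have : X \subset Y :\ g.
  by rewrite finset.subsetD1 XY inE table_prune eqxx tg finset.setDv eqxx.
move=> /subset_leq_card; rewrite cardsU1 [in X in _ -> _ <= X](cardsD1 g Y).
have -> : g \in Y by rewrite inE tg; apply/finset.set0Pn; exists a; rewrite inE.
by case: (g \notin _) => /=; lia.
Qed.

Lemma potential_iteration c c' : iteration G c c' -> potential c' < potential c.
Proof.
move=> [h hw ->]; have : potential (delete h (charge 2 c)) < potential c.
  by rewrite /potential /= [in X in _ < X](cardsD1 h) hw add1n addSn ltnS.
move: (delete _ _) => c1; apply: leq_ltn_trans.
apply: (@propagate_all_ind (fun c => potential c <= potential c1) h) => //.
move=> a g c2 _.
exact/leq_trans/potential_prune.
Qed.

Lemma potential_le c : potential c <= 2 * H.
Proof. by rewrite /potential mul2n -addnn leq_add // max_card. Qed.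

Lemma iteration_terminates : terminates dtau phi G.
Proof.
rewrite /terminates; move: (start dtau phi G) => c.
have [n] := ubnP (potential c); elim: n c => [|n IH] c; first by rewrite ltn0.
move=> cn; constructor=> c' /potential_iteration lt; apply: IH.
by apply: leq_trans lt _.
Qed.

Lemma card_states_gt0 : 0 < N.
Proof. by apply/card_gt0P; exists (s_init G). Qed.

Lemma clock_prune a g c : clock (prune a g c) <= clock c + 3.
Proof. by rewrite /prune /=; case: ifP => _ /=; lia. Qed.

(** The initial charge is at most [N.+1], and each of the at most [N.+1] predecessors costs 3 for
    [prune] and 1 for the loop. *)
Lemma clock_propagate h a c : clock (propagate G h a c) <= clock c + 5 * N.+1.
Proof.
apply: leq_trans (for_each_clock _ (clock_prune a) _) _.
have : size (enum (predecessors G h a)) <= N.+1.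
  by rewrite -cardE card_predecessors.
move: (size _) => p /=; by case: ifP => _; move: (N) => n; lia.
Qed.

(** Amortised form: an iteration costs at most [2 + #|A| * (5 * N.+1 + 1)], hence at most
    [13 * (N * #|A|)], and lowers the potential by at least 1. *)
Lemma clock_iteration c c' : iteration G c c' ->
  clock c' + 13 * (N * #|A|) * potential c' <=
  clock c + 13 * (N * #|A|) * potential c.
Proof.
move=> it; have lt := potential_iteration it.
have [A0 N0] := (actions_nonempty G, card_states_gt0).
have : clock c' <= clock c + 13 * (N * #|A|).
  case: it => h _ ->;
    apply: leq_trans (for_each_clock _ (clock_propagate h) _) _.
  rewrite -cardE /=.
  rewrite -addnA leq_add2l; move: (N) #|A| N0 A0 => n m n0 m0; nia.
have := leq_mul (leqnn (13 * (N * #|A|))) lt; rewrite mulnS; lia.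
Qed.

(** The three phases cost [H * (2 * N * #|A| + 4 * #|A| + 4)] at most, whence 10, besides the
    tabulation of the edges. *)
Lemma clock_start :
  clock (start dtau phi G) <= 10 * (H * (N * #|A|)) + N * N * #|A|.
Proof.
have [A0 N0] := (actions_nonempty G, card_states_gt0).
have short h c : clock (fill_short h c) <= clock c + #|A|.
  by rewrite /fill_short; case: ifP => _ /=; lia.
have add h a c : clock (fill_add dtau G h a c) <= clock c + (2 * N + 1).
  have : #|trans G (last (s_init G) h) a| <= N by apply: max_card.
  by rewrite /fill_add; case: ifP => _ /=; move: (N) #|_| => n m; lia.
have full h c : clock (fill_full dtau G h c) <=
  clock c + (#|A| * (2 * N + 2) + 2).
  rewrite /fill_full; case: ifP => _; last by lia.
  set c1 := for_each _ _ _.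
  have : clock c1 <= clock c + 1 + #|A| * (2 * N + 1).+1.
    by have := for_each_clock (enum A) (add h) (charge 1 c); rewrite -cardE.
  by case: ifP => _ /=; lia.
apply: leq_trans (for_each_clock _ full _) _.
rewrite -cardE.
have := for_each_clock (enum {: history}) short (initialize S A phi).
rewrite -cardE /=; move: (clock _) (H) (N) #|A| A0 N0 => t x n m m0 n0.
have H1 : x * m <= x * (n * m) by rewrite leq_mul // leq_pmull.
have H2 : x <= x * m by rewrite leq_pmulr.
have -> : x * (m * (2 * n + 2) + 2).+1 = 2 * (x * (n * m)) + 2 * (x * m) + 3 * x.
  by lia.
by rewrite [x * m.+1]mulnS; lia.
Qed.

(** 37 is 10 for the start, 26 for an initial potential of at most [2 * H], and 1 for the failed
    loop test. *)
Lemma clock_run c : clos_refl_trans config (iteration G) (start dtau phi G) c ->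
  (clock c).+1 <= 37 * (H * (N * #|A|)) + N * N * #|A|.
Proof.
move=> run.
have step c1 c2 : clos_refl_trans config (iteration G) c1 c2 ->
    clock c2 + 13 * (N * #|A|) * potential c2 <=
    clock c1 + 13 * (N * #|A|) * potential c1.
  elim=> // {c1 c2} [c1 c2|c1 c2 c3 _ le12 _ le23];
    first exact: clock_iteration.
  exact: leq_trans le23 le12.
have [A0 N0] := (actions_nonempty G, card_states_gt0).
have H0 : 0 < H by apply/card_gt0P; exists (window [::]).
have HNA : 0 < H * (N * #|A|) by rewrite !muln_gt0 H0 N0.
have := leq_mul (leqnn (13 * (N * #|A|))) (potential_le (start dtau phi G)).
have -> : 13 * (N * #|A|) * (2 * H) = 26 * (H * (N * #|A|)) by lia.
have := step _ _ run; have := clock_start; lia.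
Qed.

(** Geometric sum of the [N ^ i] for [i <= k], with ratio at least 2. *)
Lemma card_history_gt1 : 1 < N -> H <= 2 * N ^ k.
Proof.
move=> N1; rewrite card_bseq; elim: (k) => [|n IH].
  by rewrite big_ord_recr big_ord0 /= expn0.
rewrite big_ord_recr /= mul2n -addnn leq_add2r (leq_trans IH) //.
by rewrite expnS leq_mul.
Qed.

(** With a single state the sum is [k + 1], which is where the factor [k] comes from. *)
Lemma card_history : H <= 2 * k * N ^ k.
Proof.
have [N1|N1] := ltnP 1 N.
  by rewrite (leq_trans (card_history_gt1 N1)) // leq_mul // leq_pmulr.
have N_eq1 : N = 1 by apply/eqP; rewrite eqn_leq N1 card_states_gt0.
rewrite card_bseq N_eq1 (eq_bigr (fun _ => 1)) => [|i _]; last exact: exp1n.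
by rewrite sum1_card card_ord exp1n; lia.
Qed.

Lemma clock_run_le b c : H <= b * N ^ k ->
  clos_refl_trans config (iteration G) (start dtau phi G) c ->
  (clock c).+1 <= (37 * b + 1) * (N ^ k.+1 * #|A|).
Proof.
move=> Hb /clock_run; have N2 : N * N <= N ^ k.+1.
  by rewrite -[N * N]/(N ^ 2) leq_pexp2l // card_states_gt0.
have := leq_mul Hb (leqnn (N * #|A|)).
have -> : b * N ^ k * (N * #|A|) = b * (N ^ k.+1 * #|A|).
  by rewrite expnSr -!mulnA.
have := leq_mul N2 (leqnn #|A|).
rewrite mulnDl mul1n -mulnA; lia.
Qed.

End Algorithm.

Theorem theorem1 :
  exists C : nat,
  forall (k : nat) (R : realType) (d : nat) (dtau : R) (S : {fset 'rV[R]_d})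
    (A : finType) (phi : property R d) (G : game S A),
  (1 <= k)%N -> (0 < dtau)%R -> ord phi = k -> diff_safety_game dtau phi G ->
  terminates dtau phi G /\
  forall (xi : strategy S A) (n : nat), returns dtau phi G xi n ->
    ((exists xi', winning G xi') ->
       history_dependent k xi /\ maximally_permissive_winning G xi) /\
    ((1 < #|{: S}|)%N -> (n <= C * (#|{: S}| ^ k.+1 * #|A|))%N) /\
    (n <= C * k * (#|{: S}| ^ k.+1 * #|A|))%N.
Proof.
(* [37 * b + 1] is 75 for [b = 2], and at most [75 * k] for [b = 2 * k]. *)
exists 75 => k R d dtau S A phi G + _ kE HG; rewrite -kE => k_gt0.
split; first exact: iteration_terminates.
move=> _ _ [c [run w0 -> ->]]; split; last split.
- move=> ex; split; first by move=> h h' hh'; rewrite /strategy_of hh'.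
  apply: final_maximally_permissive => // xi wx.
  elim: run (invariant_start k_gt0 HG wx) => //.
    by move=> c1 c2; apply: invariant_iteration.
  by move=> c1 c2 c3 _ I12 _ I23 /I12/I23.
- by move=> N1; apply: clock_run_le (card_history_gt1 phi N1) run.
- apply: leq_trans (clock_run_le k_gt0 (card_history G k_gt0) run) _.
  by rewrite leq_mul2r; apply/orP; right; lia.
Qed.
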